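(* Let $\Sigma$ be a finite alphabet, let $a,b\in\Sigma$ be two distinct symbols, and let $\sigma$ be a valid block over $\Sigma$ of dimension $m$ with $0\le m\le 3$. Then, depending on $m$, $\sigma$ is isomorphic to a block $\bar\sigma$ given as one of the following: 1. if $m=0$, then $\bar\sigma=1$; 2. if $m=1$, then $\bar\sigma=(1,a)$; 3. if $m=2$, then $\bar\sigma=(1,a)b(1,a)$; 4. if $m=3$, then either $\bar\sigma=(1,a)(1,b)(1,a)$ or $\bar\sigma=(1,a)b(1,a)b(1,a)$.
   Context: $\Sigma^*$ is the set of finite words over $\Sigma$, $1$ denotes the empty word, $x[1]$ is the first symbol of a nonempty word $x$, and $[m]=\{1,\dots,m\}$. Blocks. For $m\ge 0$ an $m$-block is a formal expression $\sigma=x_0(1,a_1)x_1(1,a_2)\cdots x_{m-1}(1,a_m)x_m$ with $x_i\in\Sigma^*$, $a_i\in\Sigma$ (empty words $x_i=1$ are omitted from the notation); $\dim\sigma=m$; $0$-blocks are words. Equivalence of $m$-blocks is defined recursively: $0$-blocks are equivalent iff equal as words; for $m\ge1$, writing $\sigma_i=\hat\sigma_i(1,a_i)x_i$ with $\hat\sigma_i$ an $(m-1)$-block, $a_i\in\Sigma$, $x_i\in\Sigma^*$, one has $\sigma_1\equiv\sigma_2$ iff $\hat\sigma_1a_1x_1\equiv\hat\sigma_2a_2x_2$ and $\hat\sigma_1x_1\equiv\hat\sigma_2x_2$. A block is in canonical form if for every $i=1,\dots,m$ the word $x_i$ is empty or $x_i[1]\ne a_i$; each equivalence class contains exactly one block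 in canonical form. Blocks are considered up to equivalence (''='' means equivalent). Sub-blocks. For disjoint $I^+,I^-\subset[m]$, $\sigma(I^+,I^-)=x_0\lambda_1x_1\cdots\lambda_mx_m$ where $\lambda_i=a_i$ if $i\in I^+$, $\lambda_i=1$ if $i\in I^-$, and $\lambda_i=(1,a_i)$ otherwise. Validity. $\sigma$, with canonical form $x_0(1,a_1)x_1\cdots(1,a_m)x_m$, is valid if for every $i=1,\dots,m-1$ with $x_i=1$ one has $a_i\ne a_{i+1}$. Isomorphism. Two valid $m$-blocks $\sigma_1,\sigma_2$ are isomorphic if there is a permutation $\pi$ of $[m]$ such that for all $I^\pm,J^\pm\subset[m]$ with $I^+\cap I^-=\emptyset=J^+\cap J^-$: (i) $\sigma_1(I^+,I^-)$ is valid iff $\sigma_2(\pi(I^+),\pi(I^-))$ is valid; and (ii) $\sigma_1(I^+,I^-)=\sigma_1(J^+,J^-)$ and this block is valid iff $\sigma_2(\pi(I^+),\pi(I^-))=\sigma_2(\pi(J^+),\pi(J^-))$ and this block is valid. *)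

(* Defs.v *)
From HB Require Import structures.
From mathcomp Require Import all_boot all_order all_fingroup.

Set Implicit Arguments.
Unset Strict Implicit.
Unset Printing Implicit Defensive.

Section Blocks.
Variable S : finType.

(* [Ext (.. (Ext (Word x0) a1 x1) ..) am xm] encodes the formal expression
   x0 (1,a1) x1 .. (1,am) xm; the last pair is outermost. *)
Inductive block : Type :=
| Word of seq S
| Ext of block & S & seq S.

Fixpoint dim (s : block) : nat :=
  if s is Ext s' _ _ then (dim s').+1 else 0.

Definition catw (s : block) (w : seq S) : block :=
  match s with
  | Word x => Word (x ++ w)
  | Ext s' a x => Ext s' a (x ++ w)
  end.

(* An inductive predicate because the recursion on the dimension is not
   structural. Each pair of constructors is covered by at most one clause, so
   inversion gives the "only if" directions; blocks of different dimensions are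
   never equivalent. *)
Inductive block_equiv : block -> block -> Prop :=
| equiv_Word x : block_equiv (Word x) (Word x)
| equiv_Ext s1 a1 x1 s2 a2 x2 :
    block_equiv (catw s1 (a1 :: x1)) (catw s2 (a2 :: x2)) ->
    block_equiv (catw s1 x1) (catw s2 x2) ->
    block_equiv (Ext s1 a1 x1) (Ext s2 a2 x2).

Fixpoint canonical (s : block) : bool :=
  if s is Ext s' a x then canonical s' && (ohead x != Some a) else true.

(* a_i != a_(i+1) whenever x_i is empty, for 1 <= i < m. *)
Fixpoint no_repeat (s : block) : bool :=
  if s is Ext s' b _ then
    no_repeat s' && (if s' is Ext _ a [::] then a != b else true)
  else true.

(* The canonical form of a block is unique, so "exists" and "forall" agree. *)
Definition valid (s : block) : Prop :=
  exists t : block, [/\ block_equiv s t, canonical t & no_repeat t].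

Definition has_index (m : nat) (I : {set 'I_m}) (k : nat) : bool :=
  [exists i in I, val i == k].

(* Indices start from 0: in [Ext s' a x] the pair (1,a) has index [dim s'].
   The block is meant to have dimension [m], and [Ip], [Im] to be disjoint. *)
Fixpoint sub_block (m : nat) (s : block) (Ip Im : {set 'I_m}) : block :=
  match s with
  | Word x => Word x
  | Ext s' a x =>
      let t := sub_block s' Ip Im in
      if has_index Ip (dim s') then catw t (a :: x)
      else if has_index Im (dim s') then catw t x
      else Ext t a x
  end.

Definition isomorphic (m : nat) (s1 s2 : block) : Prop :=
  [/\ dim s1 = m, dim s2 = m, valid s1, valid s2 &
    exists p : {perm 'I_m}, forall Ip Im Jp Jm : {set 'I_m},
      [disjoint Ip & Im] -> [disjoint Jp & Jm] ->
      (valid (sub_block s1 Ip Im) <->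
       valid (sub_block s2 (p @: Ip) (p @: Im))) /\
      (block_equiv (sub_block s1 Ip Im) (sub_block s1 Jp Jm) /\
       valid (sub_block s1 Ip Im) <->
       block_equiv (sub_block s2 (p @: Ip) (p @: Im))
                   (sub_block s2 (p @: Jp) (p @: Jm)) /\
       valid (sub_block s2 (p @: Ip) (p @: Im)))].

End Blocks.

Arguments Word {S} _.
Arguments Ext {S} _ _ _.

(* Main.v *)
From Corelib Require Import Setoid.
Require Import Defs.
From mathcomp Require Import all_boot all_order all_fingroup.

(** A block of dimension m is a cube of words: switching each pair (1,a_i) on
or off gives 2^m words, its vertices.

- Equivalence of blocks is equality of the cubes, vertex by vertex
  ([block_equivP]).
- Validity is also visible on the vertices ([validP]): in canonical form, two
  consecutive pairs (1,a) x (1,c) are excluded from being (1,a)(1,a) exactly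
  when a x <> x c, which says that switching on the left pair only or the right
  pair only gives two distinct words. This last condition does not depend on
  the representative.
- The vertices of a sub-block are vertices of the block, and which ones they
  are depends only on the two index sets ([vertex_sub_block]).

Hence the whole isomorphism type is determined by the coincidence relation: for
which pairs of vertices the two words are equal ([coincident_isomorphic], with
the identity permutation).

In dimension at most 3, a valid block leaves room for a single coincidence.
Equal words have equal lengths, so only vertices with as many pairs on can
coincide; those that differ by exchanging two consecutive pairs never do.
In dimension 3 there remain {1,2} against {2,3}, and {1} against {3}. The first
would give a w = w c with w = x b y, so that w is a power of a, and then
a x = x b, which validity forbids ([ends_on_distinct]). The second happens or
not, and this is the alternative of the classification: it does for
(1,a)(1,b)(1,a), where both words are a, and not for
(1,a)b(1,a)b(1,a), where they are abb and bba. *)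

(** * Vertices *)

Section Vertices.
Set Implicit Arguments.
Unset Strict Implicit.
Unset Printing Implicit Defensive.

Variable S : finType.
Implicit Types (s t : block S) (u v w : seq bool) (a b c : S) (x y : seq S).

Lemma catsI x : injective (cat x).
Proof. by elim: x => //= a x IHx y z [/IHx]. Qed.

Lemma catIs x : injective (cat^~ x).
Proof.
by move=> y z /(congr1 rev); rewrite !rev_cat => /catsI/(can_inj revK).
Qed.

Lemma rcons_nseq n a : rcons (nseq n a) a = a :: nseq n a.
Proof. by elim: n => //= n ->. Qed.

(** Vertices are addressed by bit lists read from the last pair to the first,
as the last pair is outermost in a block; missing bits count as off. *)
Fixpoint vertex s v : seq S :=
  match s with
  | Word x => x
  | Ext s' a x => vertex s' (behead v) ++ (if head false v then a :: x else x)
  end.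

Lemma dim_catw s x : dim (catw s x) = dim s.
Proof. by case: s. Qed.

Lemma vertex_catw s x v : vertex (catw s x) v = vertex s v ++ x.
Proof. by case: s => [y|s a y] //=; case: (head _ _); rewrite -catA. Qed.

Lemma block_equivP s t :
  block_equiv s t <-> dim s = dim t /\ vertex s =1 vertex t.
Proof.
split=> [|[]].
  elim=> {s t} [x|s1 a1 x1 s2 a2 x2 _ [dim12 on12] _ [_ off12]] //=.
  rewrite !dim_catw in dim12; split=> [|v /=]; first by rewrite dim12.
  have := off12 (behead v); have := on12 (behead v).
  by rewrite !vertex_catw; case: (head _ _).
have [n] := ubnP (dim s); elim: n s t => // n IHn [x|s a x] [y|t b y] //=.
  by move=> _ _ /(_ [::]) /= ->; apply: equiv_Word.
rewrite ltnS => lt_sn [dim_st] eq_st; apply: equiv_Ext; apply: IHn;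
  rewrite ?dim_catw // => v; rewrite !vertex_catw.
- exact: eq_st (true :: v).
- exact: eq_st (false :: v).
Qed.

(** * Validity in terms of vertices *)

(** The bits of u belong to the pairs to the right of the two that are
exchanged, so the bound keeps both of these inside the block. *)
Definition swap_free s : Prop := forall u v, (size u).+1 < dim s ->
  vertex s (u ++ [:: true, false & v]) <> vertex s (u ++ [:: false, true & v]).

(** If a x = x c with x nonempty, then x starts with a. *)
Lemma cons_rcons_head a x c :
  ohead x != Some a -> (a :: x == rcons x c) = (x == [::]) && (a == c).
Proof.
case: x => [|b x] /= neq_ba; first by rewrite eqseq_cons andbT.
rewrite eqseq_cons; suff /negPf-> : a != b by [].
by apply: contraNneq neq_ba => ->.
Qed.

Lemma swap_free_Ext s a x : swap_free (Ext s a x) <->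
  swap_free s /\ (forall s' b y, s = Ext s' b y -> b :: y <> rcons y a).
Proof.
split=> [free_s|[free_s free_top] [|d u] v /=].
- split=> [u v lt_us eq_uv|s' b y def_s eq_by].
    by apply: (free_s (false :: u) v) => //=; rewrite eq_uv.
  apply: (free_s [::] [::]); first by rewrite def_s.
  by rewrite def_s /= -!catA -cat_rcons -eq_by cat_cons.
- case: s free_s free_top => // s' b y _ /(_ _ _ _ erefl) free_by _ /=.
  rewrite -!catA => /catsI; rewrite -cat_rcons => /catIs/esym.
  exact: free_by.
- by rewrite ltnS => lt_us /catIs; apply: free_s.
Qed.

(** Two consecutive pairs (1,b) y (1,a) exchange their roles without changing
the word when b y = y a; as y does not start with b, this is the case
y = 1, a = b that [no_repeat] excludes. *)
Lemma canonical_no_repeat s : canonical s -> no_repeat s <-> swap_free s.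
Proof.
elim: s => [x|s IHs a x] /=; first by split=> // _ u v.
case/andP=> can_s _; rewrite swap_free_Ext -(IHs can_s).
case: s can_s {IHs} => [y _|s b y /andP[_ neq_yb]].
  by split=> [_|[]] //; split.
have eq_top := cons_rcons_head a neq_yb; split.
  case/andP=> -> neq_ba; split=> // _ _ _ [_ <- <-] /eqP; rewrite eq_top.
  by case: (y) neq_ba => //= /negPf->.
case=> -> /(_ _ _ _ erefl)/eqP; rewrite eq_top.
by case: (y) => //= ->.
Qed.

(** A pair (1,a) moves to the right past the letters a that follow it. This
changes the shorter block on its left, so the recursion is on the dimension. *)
Lemma canonical_form s : exists2 t, block_equiv s t & canonical t.
Proof.
have [n] := ubnP (dim s); elim: n s => // n IHn [x|s a x] /= lt_sn.
  by exists (Word x); first exact: equiv_Word.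
have [k [y def_x neq_ya]] : exists k, exists2 y,
    x = nseq k a ++ y & ohead y != Some a.
  elim: x {lt_sn} => [|b x [k [y -> neq_ya]]]; first by exists 0, [::].
  have [->|neq_ba] := eqVneq b a; first by exists k.+1, y.
  by exists 0, (b :: nseq k a ++ y).
have [|t /block_equivP[dim_t eq_t] can_t] := IHn (catw s (nseq k a)).
  by rewrite dim_catw.
exists (Ext t a y); last by rewrite /= can_t.
apply/block_equivP; split=> [|v /=]; first by rewrite /= -dim_t dim_catw.
rewrite -eq_t vertex_catw def_x -catA; case: (head _ _) => //.
by rewrite -cat_cons -rcons_nseq cat_rcons.
Qed.

Lemma validP s : valid s <-> swap_free s.
Proof.
have equiv_free t1 t2 : dim t1 = dim t2 -> vertex t1 =1 vertex t2 ->
    swap_free t1 -> swap_free t2.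
  by move=> eq_dim eq_v free1 u v; rewrite -eq_dim -!eq_v; apply: free1.
split=> [[t [/block_equivP[dim_st eq_st] can_t]]|free_s].
  by move/(canonical_no_repeat can_t); apply: equiv_free.
have [t equiv_st can_t] := canonical_form s.
have /block_equivP[dim_st eq_st] := equiv_st.
by exists t; split=> //; apply/canonical_no_repeat/(equiv_free s).
Qed.

(** * The coincidence relation determines the isomorphism type *)

Definition coincident s t := dim s = dim t /\
  forall v w, vertex s v = vertex s w <-> vertex t v = vertex t w.

Lemma coincident_valid s t : coincident s t -> valid s <-> valid t.
Proof.
case=> dim_st co_st; rewrite !validP /swap_free dim_st.
by split=> free u v lt_u /co_st; apply: free.
Qed.

(** The vertex of a block of dimension n at which the vertex v of its sub-block
lies: the bits of v are for the remaining pairs only. *)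
Fixpoint fill m (Ip Im : {set 'I_m}) n v : seq bool :=
  if n is n'.+1 then
    if has_index Ip n' then true :: fill Ip Im n' v
    else if has_index Im n' then false :: fill Ip Im n' v
    else head false v :: fill Ip Im n' (behead v)
  else [::].

Fixpoint free_count m (Ip Im : {set 'I_m}) n : nat :=
  if n is n'.+1 then
    (~~ has_index Ip n' && ~~ has_index Im n') + free_count Ip Im n'
  else 0.

Lemma vertex_sub_block m (Ip Im : {set 'I_m}) s v :
  vertex (sub_block s Ip Im) v = vertex s (fill Ip Im (dim s) v).
Proof.
elim: s v => [x|s IHs a x] v //=.
by do 2?[case: (has_index _ _)]; rewrite ?vertex_catw /= IHs.
Qed.

Lemma dim_sub_block m (Ip Im : {set 'I_m}) s :
  dim (sub_block s Ip Im) = free_count Ip Im (dim s).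
Proof.
elim: s => [x|s IHs a x] //=.
by do 2?[case: (has_index _ _)]; rewrite ?dim_catw /= IHs.
Qed.

(** The dimension of a sub-block and the position of its vertices in the block
are the same functions of the index sets for s and t, so every sub-block of s
is coincident with the corresponding one of t, and the identity permutation
is an isomorphism. *)
Lemma coincident_isomorphic m s t : dim s = m -> valid s ->
  coincident s t -> isomorphic m s t.
Proof.
move=> dim_s val_s co_st; have [dim_st eq_st] := co_st.
have co_sub (Ip Im : {set 'I_m}) : coincident (sub_block s Ip Im) (sub_block t Ip Im).
  split=> [|v w]; first by rewrite !dim_sub_block dim_st.
  by rewrite !vertex_sub_block -dim_st; apply: eq_st.
have equiv_sub (Ip Im Jp Jm : {set 'I_m}) :
    block_equiv (sub_block s Ip Im) (sub_block s Jp Jm) <->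
    block_equiv (sub_block t Ip Im) (sub_block t Jp Jm).
  rewrite !block_equivP !dim_sub_block dim_st.
  split=> -[-> eq_v]; split=> // v; have := eq_v v;
    by rewrite !vertex_sub_block -dim_st eq_st.
split; rewrite -?dim_st //; first exact/(coincident_valid co_st).
have im1 (I : {set 'I_m}) : (1%g : {perm 'I_m}) @: I = I.
  by rewrite (eq_imset _ (@perm1 _)) imset_id.
exists 1%g => Ip Im Jp Jm _ _; rewrite !im1 equiv_sub.
by have val_st := coincident_valid (co_sub Ip Im); rewrite val_st.
Qed.

(** * Coincidences in dimension at most 3 *)

(** The part of a vertex that a block of dimension n reads. *)
Fixpoint pad n v : seq bool :=
  if n is n'.+1 then head false v :: pad n' (behead v) else [::].

Lemma vertex_pad s v : vertex s (pad (dim s) v) = vertex s v.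
Proof. by elim: s v => //= s IHs a x v; rewrite IHs. Qed.

(** Equal vertices have as many pairs on, because each of them adds one letter. *)
Lemma vertex_eq_count s v w : vertex s v = vertex s w ->
  count id (pad (dim s) v) = count id (pad (dim s) w).
Proof.
have size_vertex u :
    size (vertex s u) = size (vertex s [::]) + count id (pad (dim s) u).
  elim: s u => [x|t IHt a x] u /=; first by rewrite addn0.
  by rewrite !size_cat IHt addnAC -!addnA; case: (head _ _); rewrite //= !addnS.
move/(congr1 size); rewrite (size_vertex v) (size_vertex w).
exact: addnI.
Qed.

Lemma cons_rcons_pred1 a x c : a :: x = rcons x c -> all (pred1 a) x.
Proof. by elim: x => //= b x IHx [<- /IHx->]; rewrite eqxx. Qed.

(** In x0 (1,a) x (1,b) y (1,c) z, only the last pair is off on the left-hand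
side, and only the first one on the right-hand side. *)
Lemma ends_on_distinct s : dim s = 3 -> valid s ->
  vertex s [:: false; true; true] <> vertex s [:: true; true; false].
Proof.
case: s => // -[] // -[] // -[] // x0 a x b y c z _ /validP free /= eq_ends.
have: a :: (x ++ b :: y) = rcons (x ++ b :: y) c.
  apply: (@catsI x0); apply: (@catIs z).
  by move: eq_ends; rewrite -cats1 -!catA /= -!catA.
move/cons_rcons_pred1; rewrite all_cat => /and3P[/all_pred1P def_x /eqP def_b _].
apply: (free [:: false] [::]) => //=; rewrite def_b def_x -!catA; congr (_ ++ _).
by rewrite -cat_rcons rcons_nseq.
Qed.

(** The coincidence {1} against {3} of dimension 3, the only one that validity
leaves undecided; bits are listed from the last pair. *)
Definition ends_coincide s : bool :=
  vertex s [:: true; false; false] == vertex s [:: false; false; true].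

Lemma coincidence_cases s v w : dim s <= 3 -> valid s ->
    vertex s v = vertex s w ->
  pad (dim s) v = pad (dim s) w \/
  ends_coincide s /\
    ((pad (dim s) v, pad (dim s) w) =
       ([:: true; false; false], [:: false; false; true]) \/
     (pad (dim s) v, pad (dim s) w) =
       ([:: false; false; true], [:: true; false; false])).
Proof.
move=> le_s3 val_s eq_vw; have /validP free := val_s.
have := vertex_eq_count eq_vw; move: eq_vw.
rewrite -(vertex_pad s v) -(vertex_pad s w) /ends_coincide.
have free01 := free [::]; have free12 := free [:: false].
have free12' := free [:: true]; have free02 := @ends_on_distinct s.
case: (dim s) le_s3 free01 free12 free12' free02 => [|[|[|[|//]]]] /= _;
  repeat match goal with |- context [head false ?u] => case: (head false u) end;
  move=> free01 free12 free12' free02 //= eq_vw _;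
  (* Equal counts remain: free01 exchanges the two last pairs, free12 and
     free12' the two first ones of three, with the last pair off and on. *)
  first [ by left | by case: (free01 [::]) | by case: (free01 [:: true])
        | by case: (free01 [:: false]) | by case: (free12 [::])
        | by case: (free12' [::]) | by case: free02
        | right; rewrite eq_vw eqxx; auto ].
Qed.

(** A coincidence in one block is trivial or is that of [ends_coincide], and
either way it holds in the other block. *)
Lemma coincident_dim3 s t : dim s = dim t -> dim s <= 3 -> valid s -> valid t ->
  ends_coincide s = ends_coincide t -> coincident s t.
Proof.
have transfer s1 s2 v w : dim s1 = dim s2 -> dim s1 <= 3 -> valid s1 ->
    ends_coincide s1 = ends_coincide s2 ->
    vertex s1 v = vertex s1 w -> vertex s2 v = vertex s2 w.
  move=> dim12 le3 val1 ends12 /(coincidence_cases le3 val1).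
  rewrite -(vertex_pad s2 v) -(vertex_pad s2 w) -dim12 ends12.
  by case=> [->|[/eqP eq2 [] [-> ->]]].
move=> dim_st le3 val_s val_t ends_st; split=> // v w.
by split; apply: transfer; rewrite -?dim_st.
Qed.

End Vertices.

Theorem theorem3p28 (S : finType) (a b : S) (hab : a <> b)
  (m : nat) (hm : m <= 3) (sigma : block S)
  (hdim : dim sigma = m) (hvalid : valid sigma) :
  [/\ m = 0 -> isomorphic m sigma (Word [::]),
      m = 1 -> isomorphic m sigma (Ext (Word [::]) a [::]),
      m = 2 -> isomorphic m sigma (Ext (Ext (Word [::]) a [:: b]) a [::])
    & m = 3 ->
        isomorphic m sigma
          (Ext (Ext (Ext (Word [::]) a [::]) b [::]) a [::]) \/
        isomorphic m sigma
          (Ext (Ext (Ext (Word [::]) a [:: b]) a [:: b]) a [::])].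
Proof.
have neq_ab : a != b by apply/eqP.
have iso_sigma t : dim t = m -> canonical t -> no_repeat t ->
    ends_coincide sigma = ends_coincide t -> isomorphic m sigma t.
  move=> dim_t can_t norep_t ends_t.
  have val_t : valid t by apply/validP/canonical_no_repeat.
  apply: coincident_isomorphic => //.
  by apply: coincident_dim3 => //; rewrite hdim.
have neq_ba : b != a by rewrite eq_sym.
(* Below dimension 3, the two vertices compared by ends_coincide are equal in
   dimension 0 and of different lengths in dimensions 1 and 2. *)
have ends_low : m < 3 -> ends_coincide sigma = (m == 0).
  rewrite -hdim /ends_coincide => lt3.
  case: eqP => [/vertex_eq_count|].
    by case: (dim sigma) lt3 => [|[|[|]]].
  by rewrite -vertex_pad -[X in _ <> X]vertex_pad;
     case: (dim sigma) lt3 => [|[|[|]]].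
split=> def_m; rewrite def_m in ends_low.
- by apply: iso_sigma; rewrite ?def_m ?ends_low.
- by apply: iso_sigma; rewrite ?def_m ?ends_low.
- apply: iso_sigma; rewrite ?def_m ?ends_low /ends_coincide //= ?andbT //.
  by rewrite !eqseq_cons andbF.
case ends_s : (ends_coincide sigma); [left | right];
  apply: iso_sigma; rewrite ?def_m ?ends_s /ends_coincide //= ?andbT ?neq_ab //.
- by rewrite eqxx.
- exact/andP.
- by rewrite eqseq_cons (negPf neq_ba).
Qed.
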